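(* There are, up to the equivalence $\equiv$, exactly $15$ irreducible n-formulae, represented by the following list: $$p,\quad {\sim}{\sim}p,\quad {\sim}\neg p,\quad \neg{\sim}p,\quad \neg\neg p,\quad {\sim}{\sim}\neg\neg p,\quad \neg{\sim}{\sim}\neg p,\quad \neg\neg{\sim}{\sim}p,$$ $${\sim}p,\quad \neg p,\quad {\sim}{\sim}\neg p,\quad {\sim}\neg\neg p,\quad \neg{\sim}{\sim}p,\quad \neg\neg{\sim}p,\quad \neg{\sim}{\sim}\neg\neg p.$$ That is: each of these $15$ n-formulae is irreducible, they are pairwise not equivalent, and every irreducible n-formula is equivalent to one of them.
   Context: Fix one propositional variable $p$. The n-formulae (monadic purely negational fragment of Intuitionistic Control Logic) are the formulae built from $p$ using only two primitive unary connectives ${\sim}$ (intuitionistic negation) and $\neg$ ($\perp$-negation). The length of an n-formula is the number of negations (of both kinds) in it; $p$ has length $0$. A Kripke r-model is $\langle W,\mathbf r,\leq,\Vdash\rangle$ where $W$ is a finite non-empty set (of worlds), $\leq$ is a reflexive and transitive relation on $W$, $\mathbf r\in W$ (the root) is the least element ($\mathbf r\leq u$ for all $u\in W$), and $\Vdash$ is a forcing relation between worlds and $p$ that is monotone: $u\leq v$ and $u\Vdash p$ imply $v\Vdash p$. We write $w>\mathbf r$ when $w$ is a world properly above the root, i.e. a world other than the root. Forcing is extended to n-formulae by: $u\Vdash {\sim}A$ iff for all $w\geq u$, $w\not\Vdash A$; $u\Vdash \neg A$ iff for all $w\geq u$, $w\not\Vdash A$ or $w>\mathbf r$. For n-formulae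 $A,B$: $u\Vdash A\rightarrow B$ iff for all $v\geq u$, $v\Vdash A$ implies $v\Vdash B$. A formula is valid, written $\models$, if it is forced at every world of every r-model. Put $A\equiv B$ (equivalent) iff $\models A\rightarrow B$ and $\models B\rightarrow A$. An n-formula $A$ of length $k$ is reducible to an n-formula $B$ of length $m$ if $A\equiv B$ and $m<k$; $A$ is irreducible if it is not reducible to any n-formula. *)

(* Defs.v *)
From mathcomp Require Import all_boot.

Set Implicit Arguments.
Unset Strict Implicit.
Unset Printing Implicit Defensive.

Inductive nform : Type :=
| NVar                  (* the propositional variable p *)
| INeg of nform         (* intuitionistic negation ~ *)
| BNeg of nform.        (* bottom-negation, written as the usual negation sign *)

Fixpoint nlen (A : nform) : nat :=
  match A with
  | NVar => 0
  | INeg B => (nlen B).+1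
  | BNeg B => (nlen B).+1
  end.

(* The relation [rle] is only a preorder: antisymmetry is not required. *)
Record rmodel : Type := RModel {
  world :> finType;
  root : world;
  rle : rel world;
  rval : pred world;
  rle_refl : reflexive rle;
  rle_trans : transitive rle;
  root_least : forall u, rle root u;
  rval_mono : forall u v, rle u v -> rval u -> rval v
}.

(* "Properly above the root" is read as "different from the root". *)
Definition above_root (M : rmodel) (w : M) : bool := w != root M.

Fixpoint forces (M : rmodel) (u : M) (A : nform) : bool :=
  match A with
  | NVar => rval u
  | INeg B => [forall w : M, rle u w ==> ~~ forces w B]
  | BNeg B => [forall w : M, rle u w ==> ~~ forces w B || above_root w]
  end.

Definition forces_imp (M : rmodel) (u : M) (A B : nform) : Prop :=
  forall v : M, rle u v -> forces v A -> forces v B.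

Definition valid_imp (A B : nform) : Prop :=
  forall (M : rmodel) (u : M), forces_imp u A B.

Definition nequiv (A B : nform) : Prop := valid_imp A B /\ valid_imp B A.

Definition reducible_to (A B : nform) : Prop :=
  nequiv A B /\ nlen B < nlen A.

Definition irreducible (A : nform) : Prop :=
  ~ exists B : nform, reducible_to A B.

Definition irr_list : 15.-tuple nform :=
  [tuple
    NVar;
    INeg (INeg NVar);
    INeg (BNeg NVar);
    BNeg (INeg NVar);
    BNeg (BNeg NVar);
    INeg (INeg (BNeg (BNeg NVar)));
    BNeg (INeg (INeg (BNeg NVar)));
    BNeg (BNeg (INeg (INeg NVar)));
    INeg NVar;
    BNeg NVar;
    INeg (INeg (BNeg NVar));
    INeg (BNeg (BNeg NVar));
    BNeg (INeg (INeg NVar));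
    BNeg (BNeg (INeg NVar));
    BNeg (INeg (INeg (BNeg (BNeg NVar))))
  ].

(* Main.v *)
Require Import Defs.
From mathcomp Require Import all_boot.

(** Why the theorem holds.  An n-formula can extract very little from a model.
    At a world [u], [INeg A] asks whether [A] holds somewhere above [u]; since
    forcing is monotone and every world has a world above it where [p] is
    decided for good ([settled_above]), only such settled worlds matter, and
    among them a formula sees nothing but the truth value of [p]
    ([forces_settled]).  [BNeg A] asks about the root, and only when [u] lies
    below it.  So the truth of every n-formula at [u] is a function of five
    bits, the [profile] of [u] ([forces_value]), and at most ten profiles
    occur ([profile_coherent]).

    Equivalence is thereby reduced to finite truth tables.  The tables show
    that applying either negation to one of the fifteen formulae gives a
    formula equivalent to one of the fifteen, and never a longer one
    ([irr_list_closed]); as [p] is on the list, by induction every n-formula is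
    equivalent to a listed one of no greater length ([normal_form]).
    Conversely, seven of the profiles, realised in models with at most three
    worlds, separate the fifteen formulae ([irr_list_separated]).  If a listed
    formula were reducible, the normal form of its reduct would be a strictly
    shorter, hence different, listed formula equivalent to it, which the
    separation forbids. *)

Set Implicit Arguments.
Unset Strict Implicit.
Unset Printing Implicit Defensive.

Local Notation root := Defs.root.

(** * Equivalence as equality of truth values *)

Lemma nequivP (A B : nform) :
  nequiv A B <-> forall (M : rmodel) (u : M), forces u A = forces u B.
Proof.
split=> [[AB BA] M u | eqAB].
  by apply/idP/idP; [apply: AB | apply: BA]; apply: rle_refl.
by split=> M u v _; rewrite eqAB.
Qed.

Lemma nequiv_trans (A B C : nform) : nequiv A B -> nequiv B C -> nequiv A C.
Proof.
by move=> /nequivP AB /nequivP BC; apply/nequivP => M u; rewrite AB BC.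
Qed.

Lemma nequiv_INeg (A B : nform) : nequiv A B -> nequiv (INeg A) (INeg B).
Proof.
move=> /nequivP AB; apply/nequivP => M u /=.
by apply: eq_forallb => w; rewrite AB.
Qed.

Lemma nequiv_BNeg (A B : nform) : nequiv A B -> nequiv (BNeg A) (BNeg B).
Proof.
move=> /nequivP AB; apply/nequivP => M u /=.
by apply: eq_forallb => w; rewrite AB.
Qed.

(** * Truth depends only on the profile of a world *)

Lemma forces_mono (M : rmodel) (A : nform) (u v : M) :
  rle u v -> forces u A -> forces v A.
Proof.
case: A => [|A|A] /= uv; first exact: rval_mono.
  move=> /forallP fA; apply/forallP => w; apply/implyP => vw.
  by apply: (implyP (fA w)); apply: rle_trans vw.
move=> /forallP fA; apply/forallP => w; apply/implyP => vw.
by apply: (implyP (fA w)); apply: rle_trans vw.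
Qed.

(** The quantifier over worlds is spurious: a world other than the root
    satisfies the body for free.  [rle u (root M)] stands in place of
    [u = root M] because [rle] is only a preorder, so a world distinct from
    the root may still see it. *)
Lemma forces_BNeg (M : rmodel) (A : nform) (u : M) :
  forces u (BNeg A) = (rle u (root M) ==> ~~ forces (root M) A).
Proof.
rewrite /=; apply/forallP/implyP => [fA ur | fA w].
  by have:= fA (root M); rewrite ur /above_root eqxx orbF.
apply/implyP => uw; rewrite /above_root.
by case: eqVneq uw => [-> /fA -> | _ _]; rewrite ?orbT.
Qed.

Definition solo (M : rmodel) : bool := [forall w : M, rle w (root M)].

(** At a settled world nothing can change on the way up: the value of [p] is
    final, and so is the behaviour of [BNeg], since the cluster of the root has
    been left unless it is the whole model. *)
Definition settled (M : rmodel) (b : bool) (w : M) : bool :=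
  (rle w (root M) == solo M) && [forall v : M, rle w v ==> (rval v == b)].

Definition sees (M : rmodel) (b : bool) (u : M) : bool :=
  [exists w : M, rle u w && settled b w].

Lemma rle_root_solo (M : rmodel) (u v : M) :
  rle u v -> rle u (root M) = solo M -> rle v (root M) = solo M.
Proof.
case: (boolP (solo M)) => [/forallP all_r _ _ | _ uv u_r]; first exact: all_r.
by apply: contraFF u_r; apply: rle_trans.
Qed.

Lemma settled_up (M : rmodel) (b : bool) (u v : M) :
  rle u v -> settled b u -> settled b v.
Proof.
move=> uv /andP[/eqP u_r /forallP ub]; apply/andP; split.
  by apply/eqP; apply: rle_root_solo u_r.
apply/forallP => w; apply/implyP => vw.
by apply: (implyP (ub w)); apply: rle_trans vw.
Qed.

Lemma settled_rval (M : rmodel) (b : bool) (w : M) : settled b w -> rval w = b.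
Proof. by move=> /andP[_ /forallP/(_ w)]; rewrite rle_refl => /eqP. Qed.

(** First leave the cluster of the root if possible; then move to a world with
    [p] if there is one, and stay put otherwise. *)
Lemma settled_above (M : rmodel) (u : M) :
  exists2 v : M, rle u v & exists b, settled b v.
Proof.
have [w uw w_r] : exists2 w : M, rle u w & rle w (root M) = solo M.
  case: (boolP (solo M)) => [/forallP all_r | /forallPn[x x_r]].
    by exists u; [apply: rle_refl | apply: all_r].
  case: (boolP (rle u (root M))) => [ur | /negbTE u_r].
    by exists x; [apply: rle_trans ur (root_least x) | apply: negbTE].
  by exists u; first exact: rle_refl.
case: (boolP [exists v : M, rle w v && rval v]) => [/existsP[v] | no_p].
  move=> /andP[wv pv]; exists v; first exact: rle_trans wv.
  exists true; apply/andP; split; first by apply/eqP; apply: rle_root_solo w_r.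
  by apply/forallP => x; apply/implyP => /rval_mono -> //.
exists w => //; exists false; rewrite /settled w_r eqxx /=.
apply/forallP => v; apply/implyP => wv; rewrite eqbF_neg.
by apply: contra no_p => pv; apply/existsP; exists v; rewrite wv.
Qed.

(** The value of a formula at a settled world where [p] has value [b]; the bit
    [c] tells whether this world lies in the cluster of the root, where
    [BNeg] is a negation rather than trivially true. *)
Fixpoint settled_value (c b : bool) (A : nform) : bool :=
  match A with
  | NVar => b
  | INeg B => ~~ settled_value c b B
  | BNeg B => c ==> ~~ settled_value c b B
  end.

(** Every world above a settled one is settled with the same bit, so by the
    induction hypothesis all of them agree on the immediate subformula. *)
Lemma forces_settled (M : rmodel) (b : bool) (A : nform) (w : M) :
  settled b w -> forces w A = settled_value (solo M) b A.
Proof.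
elim: A w => [|A IH|A IH] w sw; first exact: settled_rval.
  rewrite /=; apply/forallP/idP => [/(_ w) | nA v].
    by rewrite rle_refl IH.
  by apply/implyP => wv; rewrite (IH v) //; apply: settled_up sw.
rewrite forces_BNeg /=; case/andP: (sw) => /eqP -> _.
case soloM: (solo M) => //=; move/forallP: (soloM) => all_r.
have sr : settled b (root M) by apply: settled_up sw; apply: all_r.
by rewrite (IH _ sr) soloM.
Qed.

(** The components are, in this order: the world lies below the root; every
    world of the model does; [p] holds at the world; the world sees a settled
    world with [p]; it sees one without. *)
Definition profile : Type := (bool * bool * bool * bool * bool)%type.

Definition profile_of (M : rmodel) (u : M) : profile :=
  (rle u (root M), solo M, rval u, sees true u, sees false u).

Fixpoint value (s : profile) (A : nform) : bool :=
  let: (bot, c, x, e, f) := s in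
  match A with
  | NVar => x
  | INeg B => ~~ (e && settled_value c true B || f && settled_value c false B)
  | BNeg B => bot ==> ~~ value s B
  end.

(** By monotonicity a world forcing [A] can be replaced by a settled one above
    it, so [INeg] need only be tested on settled worlds. *)
Lemma forces_INeg (M : rmodel) (A : nform) (u : M) :
  forces u (INeg A) =
    ~~ (sees true u && settled_value (solo M) true A
        || sees false u && settled_value (solo M) false A).
Proof.
apply/idP/idP => [/forallP nA | ].
  have no b : ~~ (sees b u && settled_value (solo M) b A).
    apply/negP => /andP[/existsP[w /andP[uw sw]]].
    by rewrite -(forces_settled A sw); apply/negP; apply: (implyP (nA w)).
  by rewrite negb_or !no.
apply: contraNT => /forallPn[w]; rewrite negb_imply negbK => /andP[uw wA].
have [v wv [b sv]] := settled_above w.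
have ub : sees b u.
  by apply/existsP; exists v; rewrite sv andbT; apply: rle_trans wv.
have := forces_mono wv wA; rewrite (forces_settled A sv).
by case: b {sv} ub => -> -> //; rewrite orbT.
Qed.

Lemma forces_value (M : rmodel) (A : nform) (u : M) :
  forces u A = value (profile_of u) A.
Proof.
elim: A u => [|A IH|A IH] u //; first exact: forces_INeg.
rewrite forces_BNeg /=; case: (boolP (rle u (root M))) => //= ur.
congr (~~ _); rewrite -[RHS]IH.
by apply/idP/idP; apply: forces_mono; rewrite ?root_least.
Qed.

(** The five bits are not independent: [p] is monotone, some settled world is
    always seen, and in a model with a single cluster everything is settled. *)
Definition coherent (s : profile) : bool :=
  let: (bot, c, x, e, f) := s in
  [&& e || f, x ==> e && ~~ f & c ==> [&& bot, e == x & f == ~~ x]].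

Lemma profile_coherent (M : rmodel) (u : M) : coherent (profile_of u).
Proof.
have some : sees true u || sees false u.
  have [v uv [b sv]] := settled_above u.
  have: sees b u by apply/existsP; exists v; rewrite uv.
  by case: b {sv} => ->; rewrite ?orbT.
have no_f : rval u -> ~~ sees false u.
  move=> pu; apply/existsPn => w; apply/negP => /andP[uw /settled_rval].
  by rewrite (rval_mono uw pu).
rewrite /coherent /= some /=; apply/andP; split.
  apply/implyP => pu; move: some; rewrite (negbTE (no_f pu)) orbF => ->.
  by [].
apply/implyP => /forallP all_r; rewrite all_r /=.
have no_e : ~~ rval u -> ~~ sees true u.
  apply: contra => /existsP[w /andP[_ /settled_rval pw]].
  by apply: rval_mono pw; apply: rle_trans (all_r w) (root_least u).
case: (boolP (rval u)) => [/no_f | /no_e] /negbTE no; move: some; rewrite no.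
  by rewrite orbF => ->.
by move=> /= ->.
Qed.

(** * Truth tables *)

Definition bools : seq bool := [:: true; false].

Definition add_bit (T : Type) (ts : seq T) : seq (T * bool) :=
  [seq (t, b) | t <- ts, b <- bools].

Definition coherent_profiles : seq profile :=
  [seq s <- add_bit (add_bit (add_bit (add_bit bools))) | coherent s].

Lemma mem_coherent_profiles (s : profile) :
  coherent s -> s \in coherent_profiles.
Proof.
move=> coh_s; rewrite mem_filter coh_s /=.
by case: s coh_s => [[[[[] []] []] []] []] _.
Qed.

Definition same_table (A B : nform) : bool :=
  all (fun s => value s A == value s B) coherent_profiles.

Lemma same_table_nequiv (A B : nform) : same_table A B -> nequiv A B.
Proof.
move=> /allP eqAB; apply/nequivP => M u; rewrite !forces_value.
by apply/eqP/eqAB/mem_coherent_profiles/profile_coherent.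
Qed.

(** The length bound is what lets the list represent irreducible formulae, and
    not just all formulae. *)
Definition has_listed_form (A : nform) : bool :=
  has (fun B => same_table A B && (nlen B <= nlen A)) irr_list.

Lemma irr_list_closed :
  all (fun A => has_listed_form (INeg A) && has_listed_form (BNeg A)) irr_list.
Proof. by vm_compute. Qed.

Lemma has_listed_formP (A : nform) :
  has_listed_form A ->
  exists2 i : 'I_15,
    nequiv A (tnth irr_list i) & nlen (tnth irr_list i) <= nlen A.
Proof.
by move=> /has_tnthP[i /andP[/same_table_nequiv Ai le_iA]]; exists i.
Qed.

Lemma normal_form (A : nform) :
  exists2 i : 'I_15,
    nequiv A (tnth irr_list i) & nlen (tnth irr_list i) <= nlen A.
Proof.
have /all_tnthP closed := irr_list_closed.
elim: A => [|A [i Ai le_iA]|A [i Ai le_iA]].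
- by exists ord0; first exact/nequivP.
- have /andP[/has_listed_formP[j ij le_ji] _] := closed i.
  exists j; last exact: leq_trans le_ji _.
  exact: nequiv_trans (nequiv_INeg Ai) ij.
have /andP[_ /has_listed_formP[j ij le_ji]] := closed i.
exists j; last exact: leq_trans le_ji _.
exact: nequiv_trans (nequiv_BNeg Ai) ij.
Qed.

(** * Separating models *)

Definition point_model : rmodel.
Proof.
by apply: (@RModel unit tt (fun _ _ => true) (fun _ => false)).
Defined.

Lemma profile_point_model :
  profile_of (tt : point_model) = (true, true, false, false, true).
Proof.
have solo1 : solo point_model by apply/forallP.
rewrite /profile_of solo1 /=; congr (_, _, _, _, _).
  by apply/existsP => -[w /andP[_ /settled_rval]].
apply/existsP; exists tt; rewrite /settled solo1 /=.
by apply/forallP.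
Qed.

Section Fork.

Variables x y z : bool.
Hypothesis x_le : x ==> y && z.

Definition fork_le (u v : option bool) : bool :=
  if u is Some b then v == Some b else true.

Definition fork_val (u : option bool) : bool :=
  if u is Some b then if b then y else z else x.

(** A root, where [p] has value [x], below two incomparable worlds, where it
    has values [y] and [z]. *)
Definition fork : rmodel.
Proof.
apply: (@RModel (option bool) None fork_le fork_val) => //.
- by case=> [b|] /=.
- by case=> [b|] [c|] [d|] //= /eqP ->.
by case=> [b|] [c|] //=; [move=> /eqP[->] | move=> _ xt; move: x_le;
  rewrite xt => /andP[yt zt]; case: c].
Defined.

Lemma solo_fork : solo fork = false.
Proof. by apply/negP => /forallP/(_ (Some true)). Qed.

Lemma settled_fork_root (b : bool) : settled b (None : fork) = false.
Proof. by rewrite /settled solo_fork. Qed.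

Lemma settled_fork_leaf (b c : bool) :
  settled b (Some c : fork) = (fork_val (Some c) == b).
Proof.
rewrite /settled solo_fork /=; apply/forallP/idP => [/(_ (Some c)) | cb w].
  by rewrite /= eqxx.
by apply/implyP => /eqP ->.
Qed.

Lemma profile_fork_root :
  profile_of (None : fork) = (true, false, x, y || z, ~~ (y && z)).
Proof.
rewrite /profile_of solo_fork /=.
have sees_root b : sees b (None : fork) = (y == b) || (z == b).
  apply/existsP/orP => [[[c|]] /= | [yb | zb]].
  - by rewrite settled_fork_leaf; case: c => /= ->; [left | right].
  - by rewrite settled_fork_root.
  - by exists (Some true); rewrite settled_fork_leaf.
  by exists (Some false); rewrite settled_fork_leaf.
by rewrite !sees_root; case: (y) (z) => [] [].
Qed.

Lemma profile_fork_leaf :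
  profile_of (Some true : fork) = (false, false, y, y, ~~ y).
Proof.
rewrite /profile_of solo_fork /=.
have sees_leaf b : sees b (Some true : fork) = (y == b).
  apply/existsP/idP => [[w /andP[/eqP ->]] | yb].
    by rewrite settled_fork_leaf.
  by exists (Some true); rewrite settled_fork_leaf rle_refl.
by rewrite !sees_leaf; case: (y).
Qed.

End Fork.

(** Roots alone would not do: [NVar] and [BNeg (BNeg NVar)] agree at the root
    of every model and differ only at other worlds, whence the last two
    profiles, which come from leaves of forks. *)
Definition realised_profiles : seq profile :=
  [:: (true, true, false, false, true);
      (true, false, false, true, true);
      (true, false, false, true, false);
      (true, false, false, false, true);
      (true, false, true, true, false);
      (false, false, true, true, false);
      (false, false, false, false, true)].

Lemma realised_profilesP (s : profile) :
  s \in realised_profiles -> exists (M : rmodel) (u : M), profile_of u = s.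
Proof.
rewrite !inE.
do ![case/orP]; move/eqP->.
- by exists point_model, tt; apply: profile_point_model.
- by exists (@fork false true false isT), None; rewrite profile_fork_root.
- by exists (@fork false true true isT), None; rewrite profile_fork_root.
- by exists (@fork false false false isT), None; rewrite profile_fork_root.
- by exists (@fork true true true isT), None; rewrite profile_fork_root.
- by exists (@fork false true true isT), (Some true);
    rewrite profile_fork_leaf.
by exists (@fork false false false isT), (Some true); rewrite profile_fork_leaf.
Qed.

Definition signature (A : nform) : seq bool :=
  [seq value s A | s <- realised_profiles].

(** The converse of [same_table_nequiv], restricted to profiles known to
    occur. *)
Lemma nequiv_signature (A B : nform) : nequiv A B -> signature A = signature B.
Proof.
move=> /nequivP eqAB; apply/eq_in_map => s /realised_profilesP[M [u <-]].
by rewrite -!forces_value.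
Qed.

Lemma irr_list_separated (i j : 'I_15) :
  nequiv (tnth irr_list i) (tnth irr_list j) -> i = j.
Proof.
have uniq_sig : uniq (map_tuple signature irr_list) by vm_compute.
move=> /nequiv_signature; rewrite -!(tnth_map signature).
by apply: (tuple_uniqP _ uniq_sig).
Qed.

Theorem theorem19 :
  [/\ forall i : 'I_15, irreducible (tnth irr_list i),
      forall i j : 'I_15, i <> j -> ~ nequiv (tnth irr_list i) (tnth irr_list j)
    & forall A : nform, irreducible A ->
        exists i : 'I_15, nequiv A (tnth irr_list i)].
Proof.
split=> [i [B [iB lt_Bi]] | i j ij /irr_list_separated // | A _].
  have [j Bj le_jB] := normal_form B.
  have eq_ij := irr_list_separated (nequiv_trans iB Bj).
  by move: (leq_ltn_trans le_jB lt_Bi); rewrite eq_ij ltnn.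
by have [i Ai _] := normal_form A; exists i.
Qed.
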